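(* Let $S$ be a polynomial ring over a field and let $m_1,\dots,m_n$ be the minimal monomial generators of an ideal $I\subset S$ such that $S/I$ is Cohen-Macaulay of codimension two. Let $K$ be the complete graph on vertex set $[n]=\{1,\dots,n\}$, with vertex $i$ labelled by $m_i$ and edge $\{i,j\}$ labelled by $\mathrm{lcm}(m_i,m_j)$. For $d\in\mathbb N$ let $K_{\le d}$ be the subgraph of $K$ consisting of all vertices and edges labelled with a monomial of total degree $\le d$. Consider sequences $\{F_i\}$ of subgraphs of $K$ such that (i) $F_i\subseteq F_j$ for $i\le j$, and (ii) $F_i$ is a spanning forest of $K_{\le i}$ for every $i$. For every such sequence, once $d$ is such that $K_{\le d}$ contains all vertices and is connected, $F_i=F_d$ for $i\ge d$ and $T:=F_d$ is a spanning tree of $K$. a. For every such sequence, the labelled tree $T$ gives a minimal cellular resolution of $S/I$. b. If a tree $T$ on the vertex set $[n]$, with vertex $i$ labelled by $m_i$, gives a minimal cellular resolution of $S/I$, then $T$ may be obtained by the construction above, i.e. from some sequence $\{F_i\}$ satisfying (i) and (ii).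
   Context: A spanning forest of a graph is a subgraph without cycles containing all the vertices and having the same connected components (as vertex sets) as the graph. A tree $T$ on $[n]$ with vertex $i$ labelled by $m_i$ gives a cellular resolution as follows: label the edge $\{i,j\}$ by $m_{ij}=\mathrm{lcm}(m_i,m_j)$; the cellular complex is $$0\to\bigoplus_{\{i,j\}\in T}Se_{i,j}\to\bigoplus_{i=1}^nSe_i\to S,$$ with $e_i\mapsto m_i$ and (after choosing an orientation of each edge) $e_{i,j}\mapsto \frac{m_{ij}}{m_j}e_j-\frac{m_{ij}}{m_i}e_i$. The tree gives a minimal cellular resolution of $S/I$ if this complex is a minimal free resolution of $S/I$. *)

(* Defs.v *)
From HB Require Import structures.
From mathcomp Require Import all_boot all_order all_algebra.
From mathcomp Require Import mpoly.

Set Implicit Arguments.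
Unset Strict Implicit.
Unset Printing Implicit Defensive.

Import GRing.Theory.
Local Open Scope ring_scope.

(* An sgraph is a finite simple graph whose vertex set is a subset of the
   ambient finType T, so that the subgraphs of a graph are again of this type.
   Edges are two-element sets of vertices; as edgesP is a boolean condition,
   Leibniz equality of graphs is equality of the vertex and edge sets. *)
Record sgraph (T : finType) := SGraph {
  vertices : {set T};
  edges : {set {set T}};
  edgesP : [forall e in edges, (#|e| == 2%N) && (e \subset vertices)]
}.

Section Graphs.
Variable T : finType.
Implicit Types G H : sgraph T.

(* This relation is irreflexive: [set x; x] has one element. *)
Definition adj G : rel T := fun x y => [set x; y] \in edges G.

Definition subgraph H G :=
  (vertices H \subset vertices G) && (edges H \subset edges G).

Definition components G : {set {set T}} :=
  [set [set y | connect (adj G) x y] | x in vertices G].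

Definition connected_graph G : Prop := #|components G| = 1%N.

(* A cyclic sequence of two distinct adjacent vertices traverses one edge back
   and forth; the cycles of a simple graph have at least three vertices. *)
Definition acyclic G : Prop :=
  forall c : seq T, (2 < size c)%N -> ~~ ucycleb (adj G) c.

Definition is_tree G : Prop := connected_graph G /\ acyclic G.

Definition spanning_forest H G : Prop :=
  [/\ subgraph H G, vertices H = vertices G, acyclic H
    & components H = components G].

Definition spanning_tree H G : Prop :=
  [/\ subgraph H G, vertices H = vertices G & is_tree H].

(* o e is the (source, target) pair of the oriented edge e. *)
Definition orientation G (o : {set T} -> T * T) : Prop :=
  forall e, e \in edges G -> e = [set (o e).1; (o e).2].

Lemma complete_graph_subproof :
  [forall e in [set e : {set T} | #|e| == 2%N],
     (#|e| == 2%N) && (e \subset [set: T])].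
Proof. by apply/forall_inP => e; rewrite inE subsetT andbT. Qed.

Definition complete_graph : sgraph T := SGraph complete_graph_subproof.

End Graphs.

Section CommutativeAlgebra.
Variable R : comNzRingType.
Implicit Types (g f : seq R) (P : nat -> {pred R}).

(* Membership in the ideal of R generated by the finite list g. *)
Definition in_ideal g (x : R) : Prop :=
  exists c : nat -> R, x = \sum_(i < size g) c i * g`_i.

(* A strictly increasing chain P 0 < ... < P d of prime ideals containing g,
   that is, of prime ideals of R/(g); idealr_closed includes properness. *)
Definition prime_chain g P (d : nat) : Prop :=
  (forall i, (i <= d)%N ->
     [/\ idealr_closed (P i), prime_idealr_closed (P i)
       & {subset g <= P i}]) /\
  (forall i, (i < d)%N ->
     {subset P i <= P i.+1} /\ exists2 x, x \in P i.+1 & x \notin P i).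

(* R/(g) has Krull dimension d. *)
Definition has_dim g (d : nat) : Prop :=
  (exists P, prime_chain g P d) /\
  (forall P e, prime_chain g P e -> (e <= d)%N).

(* R/(g) has codimension c in R: dim R - dim R/(g) = c. *)
Definition has_codim g (c : nat) : Prop :=
  exists d, has_dim g d /\ has_dim [::] (d + c)%N.

(* f is a regular sequence on R/(g). *)
Definition regular_seq g f : Prop :=
  (forall i, (i < size f)%N -> forall x,
     in_ideal (g ++ take i f) (f`_i * x) -> in_ideal (g ++ take i f) x) /\
  ~ in_ideal (g ++ f) 1.

(* The depth of R/(g) with respect to the ideal (a) is d. *)
Definition has_depth (a g : seq R) (d : nat) : Prop :=
  (exists f, [/\ {in f, forall x, in_ideal a x}, regular_seq g f
               & size f = d]) /\
  (forall f, {in f, forall x, in_ideal a x} -> regular_seq g f ->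
     (size f <= d)%N).

End CommutativeAlgebra.

Section PolynomialRing.
Variables (k : fieldType) (r : nat).
Local Notation S := {mpoly k[r]}.

(* Generators of the irrelevant maximal ideal of S. *)
Definition mvars : seq S := [seq 'X_i | i <- enum 'I_r].

(* The graded notion: S/(g) is Cohen-Macaulay if its depth with respect to the
   irrelevant maximal ideal equals its dimension. It is meant for homogeneous
   ideals (g). *)
Definition cohen_macaulay (g : seq S) : Prop :=
  exists d, has_depth mvars g d /\ has_dim g d.

(* 0 -> S^b -D2-> S^a -D1-> S is a minimal free resolution of S/(g).
   Vectors are rows and maps act by multiplication on the right. *)
Definition minimal_free_resolution (g : seq S) (a b : nat)
    (D2 : 'M[S]_(b, a)) (D1 : 'M[S]_(a, 1)) : Prop :=
  [/\ forall u : 'rV[S]_b, u *m D2 = 0 -> u = 0,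
      forall v : 'rV[S]_a, v *m D1 = 0 <-> exists u : 'rV[S]_b, v = u *m D2,
      forall x : S, in_ideal g x <-> exists v : 'rV[S]_a, x%:M = v *m D1,
      forall i j, in_ideal mvars (D2 i j)
    & forall i j, in_ideal mvars (D1 i j)].

End PolynomialRing.

Section LabelledGraphs.
Variables (n r : nat) (m : 'I_n -> 'X_{1..r}).
Implicit Types (d : nat) (T : sgraph 'I_n).

Definition edge_label (i j : 'I_n) : 'X_{1..r} := mlcm (m i) (m j).

Definition Kle_edges d : {set {set 'I_n}} :=
  [set e | [exists i, exists j,
    [&& e == [set i; j], i != j & (mdeg (edge_label i j) <= d)%N]]].

Lemma Kle_subproof d :
  [forall e in Kle_edges d,
     (#|e| == 2%N) && (e \subset [set i | (mdeg (m i) <= d)%N])].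
Proof.
apply/forall_inP => e; rewrite inE => /existsP[i /existsP[j]].
case/and3P=> /eqP -> nij le_d; rewrite cards2 nij /=.
have mdeg_le (u v : 'X_{1..r}) : (u <= v)%MM -> (mdeg u <= mdeg v)%N.
  by move=> le_uv; rewrite -(submK le_uv) mdegD leq_addl.
apply/subsetP => x; rewrite !inE => /orP[] /eqP ->.
- exact: leq_trans (mdeg_le _ _ (lem_mlcml _ _)) le_d.
- exact: leq_trans (mdeg_le _ _ (lem_mlcmr _ _)) le_d.
Qed.

Definition Kle d : sgraph 'I_n := SGraph (Kle_subproof d).

Definition forest_sequence (F : nat -> sgraph 'I_n) : Prop :=
  (forall i j, (i <= j)%N -> subgraph (F i) (F j)) /\
  (forall i, spanning_forest (F i) (Kle i)).

Definition Kle_spans d : Prop :=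
  vertices (Kle d) = [set: 'I_n] /\ connected_graph (Kle d).

Variable k : fieldType.
Local Notation S := {mpoly k[r]}.

Definition mongens : seq S := [seq 'X_[m i] | i <- enum 'I_n].

Definition minimal_generators : Prop :=
  forall i, ~ in_ideal ([seq 'X_[m j] | j <- enum 'I_n & j != i] : seq S) 'X_[m i].

Definition vertex_boundary : 'M[S]_(n, 1) := \col_i 'X_[m i].

(* The rows are indexed by an enumeration of the edges of T; the row of the
   edge oriented from i to j is (m_ij / m_j) e_j - (m_ij / m_i) e_i. *)
Definition edge_boundary T (o : {set 'I_n} -> 'I_n * 'I_n) :
    'M[S]_(#|edges T|, n) :=
  \matrix_(a, l)
    let: (i, j) := o (enum_val a) in
    'X_[edge_label i j - m j] *+ (l == j)
      - 'X_[edge_label i j - m i] *+ (l == i).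

(* Meaningful under the hypothesis orientation T o. *)
Definition minimal_cellular_resolution T o : Prop :=
  minimal_free_resolution mongens (edge_boundary T o) vertex_boundary.

End LabelledGraphs.

(* Main.v *)
Require Import Defs.
From mathcomp Require Import all_boot all_order all_algebra.
From mathcomp Require Import mpoly.

(* Call a set E of edges spanning if, for every monomial u, the edges of E whose
   label divides u connect all the vertices whose label divides u; equivalently,
   the edges of E give a generating set of the syzygies of I. A tree resolves S/I
   if and only if it is spanning.
   The Krull dimension of S is at least r, so S/I has a regular sequence of
   length at least r - 2 in (x); by depth sensitivity of the Koszul complex,
   H_3(x; S/I) = 0. Comparing the Koszul complex with the complex of a spanning
   set E of least cardinality, this shows that the syzygies given by E have
   no nontrivial relation, so that every edge of E is a bridge of E.
   A tree T obtained from a sequence of forests is produced by Kruskal's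
   algorithm for the total degree. If an edge f of E is not in T, some edge g of
   T crosses the cut of E at f; the label of f divides that of g because E is
   spanning, and has at least its degree because T is a Kruskal tree, so the
   labels agree and f may be replaced by g in E. Hence T contains a spanning set
   of least cardinality. *)

Set Implicit Arguments.
Unset Strict Implicit.
Unset Printing Implicit Defensive.

Import GRing.Theory.

(** * Koszul complexes *)

Section Ideals.
Local Open Scope ring_scope.
Variable R : comNzRingType.
Implicit Types (g : seq R) (p q : R).

Lemma in_ideal0 g : in_ideal g 0.
Proof. by exists (fun=> 0); rewrite big1 // => i _; rewrite mul0r. Qed.

Lemma in_idealD g p q : in_ideal g p -> in_ideal g q -> in_ideal g (p + q).
Proof.
move=> [c ->] [d ->]; exists (fun i => c i + d i).
by rewrite -big_split /=; apply: eq_bigr => i _; rewrite mulrDl.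
Qed.

Lemma in_idealMl g (c : R) p : in_ideal g p -> in_ideal g (c * p).
Proof.
move=> [d ->]; exists (fun i => c * d i).
by rewrite mulr_sumr; apply: eq_bigr => i _; rewrite mulrA.
Qed.

Lemma in_idealN g p : in_ideal g p -> in_ideal g (- p).
Proof. by rewrite -mulN1r; apply: in_idealMl. Qed.

Lemma in_idealB g p q : in_ideal g p -> in_ideal g q -> in_ideal g (p - q).
Proof. by move=> gp gq; apply/in_idealD/in_idealN. Qed.

Lemma in_ideal_sum (I : Type) (s : seq I) (P : pred I) (F : I -> R) g :
  (forall i, P i -> in_ideal g (F i)) -> in_ideal g (\sum_(i <- s | P i) F i).
Proof.
move=> gF; elim/big_rec: _ => [|i p Pi gp]; first exact: in_ideal0.
exact: in_idealD (gF i Pi) gp.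
Qed.

Lemma in_ideal_mem g p : p \in g -> in_ideal g p.
Proof.
move=> gp; have ltj : (index p g < size g)%N by rewrite index_mem.
exists (fun i => (i == index p g)%:R).
rewrite (bigD1 (Ordinal ltj)) //= eqxx mul1r nth_index // big1 ?addr0 // => i.
by rewrite -val_eqE /= => /negPf->; rewrite mul0r.
Qed.

Lemma in_ideal_sub g g' p :
  (forall q, q \in g -> in_ideal g' q) -> in_ideal g p -> in_ideal g' p.
Proof.
move=> gg' [c ->]; apply: in_ideal_sum => i _.
by apply/in_idealMl/gg'/mem_nth.
Qed.

Lemma in_ideal_rcons g f p :
  in_ideal (rcons g f) p -> exists y, in_ideal g (p - f * y).
Proof.
move=> [c ->]; exists (c (size g)); rewrite size_rcons big_ord_recr /=.
rewrite nth_rcons ltnn eqxx [f * _]mulrC addrK; apply: in_ideal_sum => i _.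
by rewrite nth_rcons ltn_ord; apply/in_idealMl/in_ideal_mem/mem_nth.
Qed.

Definition mx_in_ideal g a b (A : 'M[R]_(a, b)) : Prop :=
  forall i j, in_ideal g (A i j).

Lemma mx_in_idealD g a b (A B : 'M[R]_(a, b)) :
  mx_in_ideal g A -> mx_in_ideal g B -> mx_in_ideal g (A + B).
Proof. by move=> gA gB i j; rewrite mxE; apply: in_idealD. Qed.

Lemma mx_in_idealN g a b (A : 'M[R]_(a, b)) :
  mx_in_ideal g A -> mx_in_ideal g (- A).
Proof. by move=> gA i j; rewrite mxE; apply: in_idealN. Qed.

Lemma mx_in_ideal_mull g a b c (A : 'M[R]_(a, b)) (B : 'M[R]_(b, c)) :
  mx_in_ideal g B -> mx_in_ideal g (A *m B).
Proof.
move=> gB i j; rewrite mxE; apply: in_ideal_sum => l _; exact: in_idealMl.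
Qed.

End Ideals.

(** * The Koszul complex and depth sensitivity *)

Section Koszul.
Local Open Scope ring_scope.
Variables (R : comNzRingType) (x : nat -> R).

(** The binomial coefficient [k] over [i]. The nested recursion makes Pascal's rule hold by
    computation, so that block matrices typecheck without casts. *)
Fixpoint kos_rank (i : nat) : nat -> nat :=
  match i with
  | 0 => fun=> 1%N
  | i'.+1 => fix rk k := if k is k'.+1 then (rk k' + kos_rank i' k')%N else 0%N
  end.

Lemma kos_rank_eq0 i k : (k < i)%N -> kos_rank i k = 0%N.
Proof.
elim: k i => [|k IHk] [|i] //= lt_ki.
by rewrite -[_ k]/(kos_rank i.+1 k) !IHk // ltnW.
Qed.

(* The Koszul complex of x_0, ..., x_k is the mapping cone of multiplication by
   x_k on that of x_0, ..., x_(k-1): a chain is a column vector col_mx a b with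
   a the part free of the k-th basis vector, and
   d (col_mx a b) = col_mx (d a + x_k b) (- d b). *)
Fixpoint kos_d (k : nat) : forall i, 'M[R]_(kos_rank i k, kos_rank i.+1 k) :=
  match k with
  | 0 => fun=> 0
  | k'.+1 => fun i =>
    match i return 'M[R]_(kos_rank i k'.+1, kos_rank i.+1 k'.+1) with
    | 0 => row_mx (kos_d k' 0) (x k')%:M
    | i'.+1 => block_mx (kos_d k' i'.+1) (x k')%:M 0 (- kos_d k' i')
    end
  end.

Lemma kos_d0S k :
  kos_d k.+1 0 =
    @row_mx R (kos_rank 0 k) (kos_rank 1 k) (kos_rank 0 k) (kos_d k 0) (x k)%:M.
Proof. by []. Qed.

Lemma kos_dSS k i :
  kos_d k.+1 i.+1 =
    @block_mx R (kos_rank i.+1 k) (kos_rank i k)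
      (kos_rank i.+2 k) (kos_rank i.+1 k)
      (kos_d k i.+1) (x k)%:M 0 (- kos_d k i).
Proof. by []. Qed.

Lemma kos_dd k i : kos_d k i *m kos_d k i.+1 = 0.
Proof.
elim: k i => [|k IHk] i; first by rewrite mul0mx.
case: i => [|i].
  rewrite kos_d0S kos_dSS mul_row_block ?mulmx0 addr0 (IHk 0%N).
  by rewrite mul_mx_scalar mul_scalar_mx scalerN subrr row_mx0.
rewrite !kos_dSS mulmx_block ?mulmx0 ?mul0mx ?addr0 add0r mulNmx !mulmxN opprK.
rewrite (IHk i.+1) (IHk i) mul_mx_scalar mul_scalar_mx subrr.
exact: block_mx0.
Qed.

(** Multiplication by [f] is homotopic to zero on the Koszul complex, with homotopy [h]. *)
Definition kos_null k (f : R) : Prop :=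
  exists h : forall i, 'M[R]_(kos_rank i.+1 k, kos_rank i k),
    kos_d k 0 *m h 0%N = f%:M /\
    forall i, kos_d k i.+1 *m h i.+1 + h i *m kos_d k i = f%:M.

Lemma kos_null0 k : kos_null k 0.
Proof.
exists (fun=> 0); split=> [|i]; first by rewrite mulmx0 raddf0.
by rewrite mulmx0 mul0mx addr0 raddf0.
Qed.

Lemma kos_nullD k f g : kos_null k f -> kos_null k g -> kos_null k (f + g).
Proof.
move=> [h [h0 hS]] [h' [h'0 h'S]]; exists (fun i => h i + h' i).
split=> [|i]; first by rewrite mulmxDr h0 h'0 raddfD.
by rewrite mulmxDr mulmxDl addrACA hS h'S raddfD.
Qed.

Lemma kos_nullM k c f : kos_null k f -> kos_null k (c * f).
Proof.
move=> [h [h0 hS]]; exists (fun i => c *: h i).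
split=> [|i]; first by rewrite -scalemxAr h0 scale_scalar_mx.
by rewrite -scalemxAr -scalemxAl -scalerDr hS scale_scalar_mx.
Qed.

(** The homotopy for the last element is exterior multiplication by the last basis vector; those for
    earlier elements extend over the cone, up to a sign. *)
Lemma kos_null_var k l : (l < k)%N -> kos_null k (x l).
Proof.
elim: k => // k IHk; rewrite ltnS leq_eqVlt => /orP[/eqP->|/IHk[h [h0 hS]]].
  pose h i : 'M[R]_(kos_rank i.+1 k.+1, kos_rank i k.+1) :=
    match i return 'M_(kos_rank i.+1 k.+1, kos_rank i k.+1) with
    | 0 => col_mx 0 1%:M
    | i'.+1 => block_mx 0 0 1%:M 0
    end.
  exists h; split=> [|i]; first by rewrite kos_d0S mul_row_col mulmx0 add0r mulmx1.
  rewrite kos_dSS mulmx_block ?mulmx0 ?mul0mx ?add0r ?addr0 ?mulmx1.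
  case: i => [|i].
    rewrite kos_d0S mul_col_row ?mul0mx ?mul1mx.
    by rewrite (@add_block_mx _ _ (kos_rank 0 k)) ?add0r addr0 addNr -scalar_mx_block.
  rewrite kos_dSS mulmx_block ?mulmx0 ?mul0mx ?add0r ?addr0 ?mul1mx.
  rewrite (@add_block_mx _ _ (kos_rank i.+1 k)) ?add0r ?addr0 addNr.
  by rewrite -scalar_mx_block.
pose h' i : 'M[R]_(kos_rank i.+1 k.+1, kos_rank i k.+1) :=
  match i return 'M_(kos_rank i.+1 k.+1, kos_rank i k.+1) with
  | 0 => col_mx (h 0%N) 0
  | i'.+1 => block_mx (h i'.+1) 0 0 (- h i')
  end.
exists h'; split=> [|i]; first by rewrite kos_d0S mul_row_col mulmx0 addr0.
rewrite kos_dSS mulmx_block ?mulmx0 ?mul0mx ?add0r ?addr0 mulNmx ?mulmxN opprK.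
rewrite ?mulmxN mul_scalar_mx.
case: i => [|i].
  rewrite kos_d0S mul_col_row ?mul0mx mul_mx_scalar.
  rewrite (@add_block_mx _ _ (kos_rank 0 k)) (hS 0%N) addNr ?addr0 h0.
  by rewrite -scalar_mx_block.
rewrite kos_dSS mulmx_block ?mulmx0 ?mul0mx ?add0r ?addr0 mulNmx ?mulmxN opprK.
rewrite (@add_block_mx _ _ (kos_rank i.+1 k)) (hS i.+1) mul_mx_scalar addNr ?addr0 (hS i).
by rewrite -scalar_mx_block.
Qed.

(** The hypothesis says that each x_l is a nonzerodivisor modulo the preceding elements; exactness
    then follows by induction along the mapping cones. *)
Lemma kos_exact k p i (z : 'M[R]_(kos_rank i.+1 k, p)) :
  (forall l (a : 'M[R]_(kos_rank 1 l, p)) (b : 'M[R]_(kos_rank 0 l, p)),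
     (l < k)%N ->
     kos_d l 0 *m a + x l *: b = 0 -> exists b', b = kos_d l 0 *m b') ->
  kos_d k i *m z = 0 -> exists w, z = kos_d k i.+1 *m w.
Proof.
elim: k i z => [|k IHk] i z reg.
  by exists 0; rewrite mulmx0; apply/matrixP=> -[].
have {}IHk j y := IHk j y (fun l a b lt_lk => reg l a b (ltnW lt_lk)).
rewrite -[z](@vsubmxK _ (kos_rank i.+1 k) (kos_rank i k) p).
move: (usubmx _) (dsubmx _) => a b dz {z}.
(* If [b] is the boundary of [b'], then a + x_k b' is a cycle of the smaller complex. Such a [b']
   comes from regularity for i = 0 and from the induction hypothesis above. *)
suff [b' b'E daE] : exists2 b', b = kos_d k i *m b' & kos_d k i *m a + x k *: b = 0.
  have /IHk[a' a'E] : kos_d k i *m (a + x k *: b') = 0.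
    by rewrite mulmxDr -scalemxAr -b'E.
  exists (col_mx a' (- b')); rewrite kos_dSS mul_block_col -a'E mul_scalar_mx.
  by rewrite scalerN addrK mul0mx add0r mulNmx ?mulmxN opprK b'E.
case: i a b dz => [|i] a b dz.
  move: dz; rewrite kos_d0S mul_row_col mul_scalar_mx => dz.
  by have [b' b'E] := reg _ _ _ (ltnSn k) dz; exists b'.
move: dz; rewrite kos_dSS mul_block_col mul_scalar_mx mul0mx add0r mulNmx.
rewrite -col_mx0 => /eq_col_mx[dab /eqP]; rewrite oppr_eq0 => /eqP/IHk[b' b'E].
by exists b'.
Qed.

(** The vanishing of H_(i+1) of the Koszul complex with coefficients in R/(g); the index is shifted
    by one. *)
Definition kos_vanish g k i : Prop :=
  forall z : 'M[R]_(kos_rank i.+1 k, 1), mx_in_ideal g (kos_d k i *m z) ->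
  exists w, mx_in_ideal g (z - kos_d k i.+1 *m w).

(* Depth sensitivity: f * z is the boundary of h z modulo (g), so a nonzero
   class of degree i+1 modulo (g) yields a nonzero class of degree i+2 modulo
   (g, f). *)
Lemma kos_vanish_rcons g f k i : kos_null k f ->
  (forall y, in_ideal g (f * y) -> in_ideal g y) ->
  kos_vanish (rcons g f) k i.+1 -> kos_vanish g k i.
Proof.
move=> [h [_ hS]] f_reg van z gdz.
have dhz : kos_d k i.+1 *m (h i.+1 *m z) = f *: z - h i *m (kos_d k i *m z).
  by rewrite !mulmxA -mul_scalar_mx -(hS i) mulmxDl addrK.
have g_gf p : in_ideal g p -> in_ideal (rcons g f) p.
  by apply: in_ideal_sub => q gq; apply: in_ideal_mem; rewrite mem_rcons inE gq orbT.
have [|v gv] := van (h i.+1 *m z).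
  rewrite dhz; apply: mx_in_idealD.
    move=> s t; rewrite mxE mulrC; apply/in_idealMl/in_ideal_mem.
    by rewrite mem_rcons mem_head.
  by apply: mx_in_idealN => s t; apply: g_gf; apply: mx_in_ideal_mull.
have /fin_all_exists[y gy] s := in_ideal_rcons (gv s 0).
exists (\col_s y s) => s t; rewrite ord1; apply: f_reg; set w := \col_s y s.
have gw : mx_in_ideal g (h i.+1 *m z - kos_d k i.+2 *m v - f *: w).
  by move=> s' t'; rewrite ord1 !mxE; move: (gy s'); rewrite !mxE.
have := mx_in_idealD (mx_in_ideal_mull (kos_d k i.+1) gw)
  (mx_in_ideal_mull (h i) gdz).
rewrite !mulmxBr dhz (mulmxA (kos_d k i.+1)) kos_dd mul0mx subr0 -scalemxAr.
rewrite addrAC subrK -scalerBr => /(_ s 0); by rewrite mxE.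
Qed.

(** Each element of the regular sequence is traded for one more degree, until the degree exceeds
    [k], where the complex is zero. *)
Lemma kos_vanish_regular g f k i :
  {in f, forall p, kos_null k p} -> regular_seq g f ->
  (k <= i + size f)%N -> kos_vanish g k i.
Proof.
elim: f g i => [|p f IHf] g i null_f [reg_f g1] le_k.
  move=> z _; exists 0 => s; have := ltn_ord s.
  by rewrite [X in (_ < X)%N]kos_rank_eq0 // ltnS; rewrite addn0 in le_k.
have /IHf IH : {in f, forall q, kos_null k q}.
  by move=> q fq; apply: null_f; rewrite inE fq orbT.
apply: (kos_vanish_rcons (f := p)) => [|y|].
- by apply: null_f; rewrite mem_head.
- by have := reg_f 0%N isT y; rewrite take0 cats0.
apply: IH; last by rewrite addSnnS.
split=> [j lt_j y|]; rewrite cat_rcons //; exact: (reg_f j.+1 lt_j).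
Qed.

End Koszul.

(** * The Koszul complex of the variables and the dimension of the polynomial ring *)

Section Polynomials.
Local Open Scope ring_scope.
Variables (k : fieldType) (r : nat).
Local Notation S := {mpoly k[r]}.
Local Notation x := (fun i => (mvars k r)`_i).
Implicit Types (p q : S) (w : 'X_{1..r}).

Lemma size_mvars : size (mvars k r) = r.
Proof. by rewrite size_map size_enum_ord. Qed.

Lemma nth_mvars (l : 'I_r) : (mvars k r)`_l = 'X_l.
Proof. by rewrite (nth_map l) ?size_enum_ord // nth_ord_enum. Qed.

Lemma mcoeffMXE p (m w : 'X_{1..r}) :
  (p * 'X_[m])@_w = if (m <= w)%MM then p@_(w - m) else 0.
Proof.
case: ifP => [le_mw|/negP not_le]; last first.
  rewrite mcoeffM big1 // => -[u v] /= /eqP wE; rewrite mcoeffX.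
  by case: eqP => [mE|_]; rewrite ?mulr0 //; case: not_le; rewrite wE mE lem_addl.
by have := mcoeffMX p m (w - m); rewrite addmC submK.
Qed.

Lemma mcoeffXlM p l w :
  ('X_l * p)@_w = if w l == 0%N then 0 else p@_(w - U_(l)).
Proof. by rewrite mulrC mcoeffMXE lep1mP; case: eqP. Qed.

Lemma mpoly_split_var p (l : 'I_r) : exists q p',
  p = 'X_l * q + p' /\ forall w, p'@_w = if w l == 0%N then p@_w else 0.
Proof.
elim/mpolyind: p => [|c m p _ _ [q [p' [pE p'E]]]].
  by exists 0, 0; rewrite mulr0 addr0; split=> // w; rewrite mcoeff0 if_same.
case: (eqVneq (m l) 0%N) => [ml0|ml0].
  exists q, (c *: 'X_[m] + p'); split; first by rewrite {1}pE addrCA.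
  move=> w; rewrite !mcoeffD p'E !mcoeffZ mcoeffX.
  case: (m =P w) => [<-|_]; last by rewrite mulr0 !add0r; case: ifP.
  by rewrite ml0 eqxx.
exists (c *: 'X_[m - U_(l)] + q), p'; split.
  rewrite {1}pE mulrDr -scalerAr -mpolyXD addmC submK; first by rewrite addrA.
  by rewrite lep1mP.
move=> w; rewrite p'E !mcoeffD !mcoeffZ mcoeffX.
case: ifP => // wl0; case: (m =P w) => [mw|_]; last by rewrite mulr0 !add0r.
by move: ml0; rewrite mw wl0.
Qed.

(** In each column the image is the ideal of the first [h] variables. It is a monomial ideal, so
    membership can be read off the coefficients. *)
Lemma kos_d0_image h n (v : 'M[S]_(kos_rank 0 h, n)) : (h <= r)%N ->
  (exists a, v = kos_d x h 0 *m a) <->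
  forall j w, (forall l : 'I_r, (l < h)%N -> w l = 0%N) -> (v 0 j)@_w = 0.
Proof.
elim: h v => [|h IHh] v le_hr.
  split=> [[a ->] j w _|v0]; first by rewrite mul0mx mxE mcoeff0.
  exists 0; rewrite mulmx0; apply/matrixP=> i j; rewrite [i]ord1 [RHS]mxE.
  by apply/mpolyP=> w; rewrite mcoeff0 v0.
have xh : x h = 'X_(Ordinal le_hr) by rewrite -nth_mvars.
split=> [[a ->] j w w0|v0].
  rewrite -[a](@vsubmxK _ (kos_rank 1 h) (kos_rank 0 h) n).
  rewrite kos_d0S mul_row_col mul_scalar_mx mxE [X in _ + X]mxE mcoeffD.
  rewrite [x h]xh mcoeffXlM (w0 (Ordinal le_hr)) //= addr0.
  apply: ((IHh _ (ltnW le_hr)).1 _ j w) => [|l lt_lh]; first by eexists.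
  by rewrite w0 // ltnW.
have sp j : exists qp : S * S, v 0 j = 'X_(Ordinal le_hr) * qp.1 + qp.2 /\
    forall w, qp.2@_w = if w (Ordinal le_hr) == 0%N then (v 0 j)@_w else 0.
  by have [q [p' qpE]] := mpoly_split_var (v 0 j) (Ordinal le_hr); exists (q, p').
have [qp qpE] := fin_all_exists sp.
have [|a aE] := (IHh (\row_j (qp j).2) (ltnW le_hr)).2.
  move=> j w w0; rewrite mxE (qpE j).2; case: eqP => // wl0; apply: v0 => l.
  rewrite ltnS leq_eqVlt => /orP[/eqP lh|]; last exact: w0.
  by rewrite (_ : l = Ordinal le_hr) //; apply: val_inj.
exists (col_mx a (\row_j (qp j).1 : 'M_(kos_rank 0 h, n))).
rewrite kos_d0S mul_row_col mul_scalar_mx -aE.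
apply/matrixP=> i j; rewrite [i]ord1 !mxE addrC [x h]xh.
by have [<-] := qpE j.
Qed.

Lemma kos_exact_mvars n i (z : 'M[S]_(kos_rank i.+1 r, n)) :
  kos_d x r i *m z = 0 -> exists y, z = kos_d x r i.+1 *m y.
Proof.
apply: kos_exact => l a b lt_lr abE; apply/(kos_d0_image _ (ltnW lt_lr)).
pose l' := Ordinal lt_lr; have xl : x l = 'X_l' by rewrite -nth_mvars.
(* The coefficient of [b] at [w] is read off at w + U_(l'), an exponent that still avoids the first
   [l] variables, so that the boundary of [a] contributes nothing there. *)
move=> j w w0; have w'0 (m : 'I_r) : (m < l)%N -> (w + U_(l'))%MM m = 0%N.
  move=> lt_ml; rewrite mnmDE mnm1E w0 // add0n.
  by case: eqP => // lm; move: lt_ml; rewrite -lm ltnn.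
have := (kos_d0_image (kos_d x l 0 *m a) (ltnW lt_lr)).1 (ex_intro _ a erefl).
move=> /(_ j _ w'0) dax0.
have /(congr1 (mcoeff (w + U_(l'))%MM)) : (kos_d x l 0 *m a + x l *: b) 0 j = 0.
  by rewrite abE mxE.
by rewrite mxE mcoeffD dax0 add0r mcoeff0 mxE [x l]xl mulrC addmC mcoeffMX.
Qed.

(** The entries of this differential are variables, so it raises the order of vanishing at the
    origin by one. *)
Lemma kos_d0_order N n (b : 'M[S]_(kos_rank 1 r, n)) :
  (forall i j w, (mdeg w < N)%N -> (b i j)@_w = 0) ->
  forall j w, (mdeg w < N.+1)%N -> ((kos_d x r 0 *m b) 0 j)@_w = 0.
Proof.
move=> b0 j w ltw; rewrite mxE raddf_sum big1 //= => i _.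
have : exists l, kos_d x r 0 0 i = 'X_l.
  move: i {b b0}; suff H h : (h <= r)%N -> forall i, exists l, kos_d x h 0 0 i = 'X_l.
    exact: H.
  elim: h => [|h IHh] lt_hr i; first by case: i.
  rewrite kos_d0S -[i](splitK i); case: (split i) => i' /=.
    by rewrite row_mxEl; apply/IHh/ltnW.
  rewrite row_mxEr [i']ord1 mxE eqxx mulr1n; exists (Ordinal lt_hr).
  by rewrite -nth_mvars.
case=> l ->; rewrite mcoeffXlM; case: eqP => // /eqP wl0; apply: b0.
have : (U_(l) <= w)%MM by rewrite lep1mP.
by move=> /submK wE; move: ltw; rewrite -{1}wE mdegD mdeg1 addn1.
Qed.

Lemma kos_null_mvars p : in_ideal (mvars k r) p -> kos_null x r p.
Proof.
case=> c ->; elim/big_rec: _ => [|i q _ nq]; first exact: kos_null0.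
apply: kos_nullD nq; apply: kos_nullM; apply: (kos_null_var x).
by rewrite -[X in (_ < X)%N]size_mvars.
Qed.

Lemma in_mvarsX w : w != 0%MM -> in_ideal (mvars k r) 'X_[w].
Proof.
move=> w0; have [l wl] : exists l, w l != 0%N.
  apply/existsP; apply: contraNT w0; rewrite negb_exists => /forallP w0.
  by apply/eqP/mnmP=> l; rewrite mnm0E; apply/eqP; rewrite -[_ == _]negbK.
have /submK <- : (U_(l) <= w)%MM by rewrite lep1mP.
rewrite mpolyXD; apply/in_idealMl/in_ideal_mem/mapP.
by exists l => //; rewrite mem_enum.
Qed.

(* The ideal (x_0, ..., x_(i-1)) is the kernel of the substitution killing
   these variables. *)
Definition kill_vars i : r.-tuple S :=
  [tuple if (l < i)%N then 0 else 'X_l | l < r].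

Lemma comp_kill_vars i (l : 'I_r) :
  'X_l \mPo kill_vars i = if (l < i)%N then 0 else 'X_l.
Proof. by rewrite comp_mpolyXU -tnth_nth tnth_mktuple. Qed.

(** The kernels are prime because S is a domain, and they increase because killing i+1 variables
    factors through killing i. The chain bounds the Krull dimension of S below by [r]. *)
Lemma prime_chain_mvars :
  prime_chain [::] (fun i => [pred p : S | p \mPo kill_vars i == 0]) r.
Proof.
split=> [i le_ir|i lt_ir].
  split=> //.
    split=> [||a p q]; rewrite ?inE ?rmorph0 ?rmorph1 ?oner_eq0 //.
    by move=> /eqP p0 /eqP q0; rewrite rmorphD rmorphM /= p0 q0 mulr0 addr0.
  by move=> p q; rewrite !inE rmorphM mulf_eq0.
split=> [p|]; last first.
  exists 'X_(Ordinal lt_ir); rewrite inE comp_kill_vars /= ?ltnSn //.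
  by rewrite ltnn -msize_poly_eq0 msizeX.
rewrite !inE => /eqP p0.
suff -> : p \mPo kill_vars i.+1 = (p \mPo kill_vars i) \mPo kill_vars i.+1.
  by rewrite p0 comp_mpoly0.
elim/mpolyind: p {p0} => [|c m p _ _ IHp]; first by rewrite !comp_mpoly0.
rewrite !comp_mpolyD -IHp !comp_mpolyZ; congr (_ *: _ + _).
rewrite mpolyXE_id !rmorph_prod; apply: eq_bigr => l _ /=.
rewrite !rmorphXn /=; congr (_ ^+ _); rewrite !comp_kill_vars.
by have [lt_li|] := ltnP l i; rewrite ?comp_mpoly0 ?comp_kill_vars // ltnW.
Qed.

End Polynomials.

(** * Syzygies of monomials *)

Section Links.
Variable V : finType.
Implicit Types (P Q : pred (V * V)) (C : {set V}) (e : rel V).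

(** Edges are ordered pairs, since a syzygy belongs to an oriented edge; connectivity forgets the
    orientation. *)
Definition link P : rel V := fun x y => P (x, y) || P (y, x).

Lemma link_sym P : ssrbool.symmetric (link P).
Proof. by move=> x y; rewrite /link orbC. Qed.

Lemma connect_link_sym P : connect_sym (link P).
Proof. exact/sym_connect_sym/link_sym. Qed.

Lemma sub_connect_link P Q : subpred P Q ->
  subrel (connect (link P)) (connect (link Q)).
Proof.
move=> PQ; apply: connect_sub => x y /orP[] /PQ Qxy;
by apply: connect1; rewrite /link Qxy ?orbT.
Qed.

Lemma connect_crossing e C x y : connect e x y -> x \in C -> y \notin C ->
  exists u v, [/\ e u v, u \in C & v \notin C].
Proof.
case/connectP=> p; elim: p x => [|z p IHp] x /=; first by move=> _ -> ->.
case/andP=> exz pth yE xC yNC; have [zC|zNC] := boolP (z \in C).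
  exact: IHp pth yE zC yNC.
by exists x, z.
Qed.

Lemma mem_connect_class e a x y : connect_sym e -> connect e x y ->
  (x \in [set z | connect e a z]) = (y \in [set z | connect e a z]).
Proof.
move=> sym exy; rewrite !inE; apply/idP/idP => ea; apply: connect_trans ea _ => //.
by rewrite sym.
Qed.

End Links.

(** * Syzygies of edges, cuts and paths *)

Section MonomialSyzygies.
Local Open Scope ring_scope.
Variables (n r : nat) (m : 'I_n -> 'X_{1..r}) (k : fieldType).
Local Notation S := {mpoly k[r]}.
Local Notation V := 'I_n.
Local Notation D1 := (vertex_boundary m k).
Implicit Types (e : V * V) (u w : 'X_{1..r}) (C : {set V}).

Definition label e : 'X_{1..r} := edge_label m e.1 e.2.

Lemma label_le e u : (label e <= u)%MM = (m e.1 <= u)%MM && (m e.2 <= u)%MM.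
Proof. exact: lem_mlcm. Qed.

Definition edge_syz e : 'rV[S]_n :=
  'X_[label e - m e.2] *: delta_mx 0 e.2 - 'X_[label e - m e.1] *: delta_mx 0 e.1.

Definition syz_mx b (s : 'I_b -> V * V) : 'M[S]_(b, n) :=
  \matrix_i edge_syz (s i).

Lemma mul_syz_mx b (s : 'I_b -> V * V) (a : 'rV[S]_b) :
  a *m syz_mx s = \sum_i a 0 i *: edge_syz (s i).
Proof. by rewrite mulmx_sum_row; apply: eq_bigr => i _; rewrite rowK. Qed.

(* Rescaling the l-th coordinate by m_l turns the syzygy of an edge into
   lcm times the incidence vector of this edge. *)
Lemma edge_syzX e (l : V) :
  edge_syz e 0 l * 'X_[m l] = 'X_[label e] * ((l == e.2)%:R - (l == e.1)%:R).
Proof.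
rewrite !mxE eqxx /= mulrBl mulrBr -!mulrA; congr (_ - _).
  case: eqP => [->|_]; rewrite ?mul0r ?mulr0 // mul1r mulr1 -mpolyXD submK //.
  exact: lem_mlcmr.
case: eqP => [->|_]; rewrite ?mul0r ?mulr0 // mul1r mulr1 -mpolyXD submK //.
exact: lem_mlcml.
Qed.

Lemma mul_vertex_boundary (v : 'rV[S]_n) :
  (v *m D1) 0 0 = \sum_l v 0 l * 'X_[m l].
Proof. by rewrite mxE; apply: eq_bigr => l _; rewrite mxE. Qed.

Lemma sum_indic (T : finType) (A : {set T}) (t : T) :
  \sum_(l in A) (l == t)%:R = (t \in A)%:R :> S.
Proof.
have [tA|tA] := boolP (t \in A).
  by rewrite (bigD1 t) //= eqxx big1 ?addr0 // => l /andP[_ /negPf->].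
by rewrite big1 // => l lA; case: eqP => // lt; rewrite -lt lA in tA.
Qed.

(** The functional attached to a vertex set [C] sees exactly the edges that cross [C]; it turns
    relations between syzygies into statements on connectivity. *)
Lemma edge_syz_cut e C :
  \sum_(l in C) edge_syz e 0 l * 'X_[m l] =
    'X_[label e] * ((e.2 \in C)%:R - (e.1 \in C)%:R).
Proof.
rewrite (eq_bigr _ (fun l _ => edge_syzX e l)) -mulr_sumr sumrB.
by rewrite !sum_indic.
Qed.

Lemma edge_syzK e : edge_syz e *m D1 = 0.
Proof.
apply/matrixP=> i j; rewrite [i]ord1 [j]ord1 mul_vertex_boundary mxE.
have := edge_syz_cut e [set: V]; rewrite !inE subrr mulr0.
by under eq_bigl => l do rewrite inE.
Qed.

Lemma syz_mxK b (s : 'I_b -> V * V) : syz_mx s *m D1 = 0.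
Proof. by apply/row_matrixP=> i; rewrite row_mul rowK edge_syzK row0. Qed.

Lemma syz_mx_cut b (s : 'I_b -> V * V) (a : 'rV[S]_b) C :
  \sum_(l in C) (a *m syz_mx s) 0 l * 'X_[m l] =
    \sum_i a 0 i * 'X_[label (s i)] * (((s i).2 \in C)%:R - ((s i).1 \in C)%:R).
Proof.
rewrite mul_syz_mx; under eq_bigr => l _ do rewrite summxE mulr_suml.
rewrite exchange_big /=; apply: eq_bigr => i _.
rewrite -mulrA -edge_syz_cut mulr_sumr; apply: eq_bigr => l _.
by rewrite mxE mulrA.
Qed.

Lemma mcoeff_syz_cut b (s : 'I_b -> V * V) (a : 'rV[S]_b) C u :
  (\sum_(l in C) (a *m syz_mx s) 0 l * 'X_[m l])@_u =
    \sum_i (a 0 i * 'X_[label (s i)])@_u *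
      (((s i).2 \in C)%:R - ((s i).1 \in C)%:R).
Proof.
rewrite syz_mx_cut raddf_sum; apply: eq_bigr => i _ /=.
by do 2!case: (_ \in C); rewrite ?subrr ?subr0 ?sub0r ?mulrN ?mulr1 ?mulr0
  ?mcoeffN ?mcoeff0.
Qed.

(** At the coefficient of [u], the functional of [C] sees only crossing edges whose label divides
    [u]. If edge [i] were the only one, its nonzero term could not cancel. *)
Lemma syz_relation_cut b (s : 'I_b -> V * V) (a : 'rV[S]_b) i u C :
  a *m syz_mx s = 0 -> (a 0 i * 'X_[label (s i)])@_u != 0 ->
  (forall j, j != i -> (label (s j) <= u)%MM ->
     ((s j).1 \in C) = ((s j).2 \in C)) ->
  ((s i).1 \in C) = ((s i).2 \in C).
Proof.
move=> a0 ai C_closed; have := mcoeff_syz_cut s a C u.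
rewrite a0 big1 => [|l _]; last by rewrite mxE mul0r.
rewrite mcoeff0 (bigD1 i) //= big1 => [|j ji].
  rewrite addr0 => /esym/eqP; rewrite mulf_eq0 (negPf ai) /= subr_eq0.
  by do 2!case: (_ \in C); rewrite // ?oner_eq0 // eq_sym oner_eq0.
have [le_ju|not_le] := boolP (label (s j) <= u)%MM.
  by rewrite C_closed // subrr mulr0.
by rewrite mcoeffMXE (negPf not_le) mul0r.
Qed.

(** If [e] crosses [C], then the functional of [C], at the coefficient of [label e], is nonzero on
    the syzygy of [e], hence on some row used to express it. *)
Lemma syz_exact_cut b (s : 'I_b -> V * V) :
  (forall v : 'rV[S]_n, v *m D1 = 0 -> exists a, v = a *m syz_mx s) ->
  forall e C, (forall j, (label (s j) <= label e)%MM ->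
     ((s j).1 \in C) = ((s j).2 \in C)) ->
  (e.1 \in C) = (e.2 \in C).
Proof.
move=> ex_s e C C_closed; have [a aE] := ex_s _ (edge_syzK e).
have := mcoeff_syz_cut s a C (label e); rewrite -aE edge_syz_cut big1 => [|j _].
  do 2!case: (_ \in C); rewrite // ?subr0 ?sub0r ?mulrN mulr1 ?mcoeffN mcoeffX;
  by rewrite eqxx => /eqP; rewrite ?oppr_eq0 oner_eq0.
have [le_je|not_le] := boolP (label (s j) <= label e)%MM.
  by rewrite C_closed // subrr mulr0.
by rewrite mcoeffMXE (negPf not_le) mul0r.
Qed.

(** In multidegree [u] a syzygy is a difference of one term for each endpoint, so that sums along a
    path telescope. *)
Lemma edge_syz_scale e u : (label e <= u)%MM ->
  'X_[u - label e] *: edge_syz e =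
    'X_[u - m e.2] *: delta_mx 0 e.2 - 'X_[u - m e.1] *: delta_mx 0 e.1.
Proof.
move=> le_u; rewrite scalerBr !scalerA -!mpolyXD.
have subK z : (m z <= label e)%MM -> (u - label e + (label e - m z) = u - m z)%MM.
  move=> le_z; apply: (@addIm _ (m z)).
  by rewrite -addmA !submK // (lepm_trans le_z).
by rewrite !subK ?lem_mlcml ?lem_mlcmr.
Qed.

Section Submodule.
(** An arbitrary submodule: later the row space of a matrix of syzygies, or the span of all its rows
    but one. *)
Variable W : 'rV[S]_n -> Prop.
Hypotheses (W0 : W 0) (WD : forall v v', W v -> W v' -> W (v + v'))
  (WZ : forall a v, W v -> W (a *: v)).

Let mono u l : 'rV[S]_n := 'X_[u - m l] *: delta_mx 0 l.

Lemma path_syz (P : pred (V * V)) u x y :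
  (forall e, P e -> (label e <= u)%MM /\ W (edge_syz e)) ->
  connect (link P) x y ->
  W ('X_[u - m y] *: delta_mx 0 y - 'X_[u - m x] *: delta_mx 0 x).
Proof.
move=> PW; have monoP x1 y1 : P (x1, y1) -> W (mono u y1 - mono u x1).
  by move=> /PW[le_u /(WZ 'X_[u - label (x1, y1)])]; rewrite edge_syz_scale.
have linkP x1 y1 : link P x1 y1 -> W (mono u y1 - mono u x1).
  case/orP=> [/monoP|/monoP/(WZ (-1))]; first exact.
  by rewrite scaleN1r opprB.
case/connectP=> p; elim: p x => [|z p IHp] x /= => [_ ->|]; first by rewrite subrr.
case/andP=> /linkP Wxz /IHp IH /IH Wzy.
by have := WD Wzy Wxz; rewrite addrA subrK.
Qed.

(** Modulo [W], all terms of a given multidegree agree with that of one representative vertex, and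
    the coefficients of a syzygy in each multidegree sum to zero. *)
Lemma syz_generated (E : pred (V * V)) :
  (forall e, E e -> W (edge_syz e)) ->
  (forall x y, connect (link [pred e | E e && (label e <= label (x, y))%MM]) x y) ->
  forall v, v *m D1 = 0 -> W v.
Proof.
move=> EW gen v /(congr1 (fun A : 'M_1 => A 0 0)).
rewrite mul_vertex_boundary mxE => v0.
have W_sum (I : Type) (t : seq I) (P : pred I) F :
    (forall i, P i -> W (F i)) -> W (\sum_(i <- t | P i) F i).
  by move=> WF; elim/big_ind: _.
have monoW u x y : (m x <= u)%MM -> (m y <= u)%MM -> W (mono u y - mono u x).
  move=> le_x le_y; apply: path_syz (gen x y) => e /= /andP[/EW We le_e].
  by split=> //; apply: lepm_trans le_e _; rewrite label_le le_x.
pose rep u := if [pick x | (m x <= u)%MM] is Some x then mono u x else 0.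
have repW u x : (m x <= u)%MM -> W (mono u x - rep u).
  rewrite /rep => le_x; case: pickP => [y le_y|/(_ x)]; last by rewrite le_x.
  exact: monoW.
(* [B] bounds the degrees that occur, which makes the sum over multidegrees finite. *)
pose B := (\max_(l < n) msize (v 0%R l * 'X_[m l])%R)%N.
have coef_v x : v 0 x =
    \sum_(w : 'X_{1..r < B} | (m x <= w)%MM)
      (v 0 x * 'X_[m x])@_w *: 'X_[w - m x].
  have Xn0 : 'X_[m x] != 0 :> S by rewrite -msize_poly_eq0 msizeX.
  apply: (mulIf Xn0); rewrite mulr_suml.
  rewrite {1}(@mpolywE r _ B (v 0 x * 'X_[m x])); last first.
    exact: (leq_bigmax x).
  rewrite (bigID (fun w : 'X_{1..r < B} => m x <= w)%MM) /= addrC big1 ?add0r.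
    by apply: eq_bigr => w le_x; rewrite -scalerAl -mpolyXD submK.
  by move=> w /negPf le_x; rewrite mcoeffMXE le_x scale0r.
have -> : v = \sum_x \sum_(w : 'X_{1..r < B} | (m x <= w)%MM)
    ((v 0 x * 'X_[m x])@_w)%:MP *: (mono w x - rep w).
  under eq_bigr => x _ do (under eq_bigr => w _ do rewrite scalerBr).
  under eq_bigr => x _ do rewrite sumrB.
  rewrite sumrB [X in _ - X](_ : _ = 0) ?subr0.
    rewrite {1}[v]row_sum_delta; apply: eq_bigr => x _.
    rewrite {1}coef_v scaler_suml; apply: eq_bigr => w _.
    by rewrite /mono scalerA mul_mpolyC.
  under eq_bigr => x _ do rewrite big_mkcond /=.
  rewrite exchange_big big1 //= => w _.
  transitivity (((\sum_x v 0 x * 'X_[m x])@_w)%:MP *: rep w).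
    rewrite !raddf_sum scaler_suml; apply: eq_bigr => x _ /=.
    by case: ifP => // le_x; rewrite mcoeffMXE le_x mpolyC0 scale0r.
  by rewrite v0 mcoeff0 mpolyC0 scale0r.
by apply: (W_sum) => x _; apply: W_sum => w le_x; apply/WZ/repW.
Qed.

End Submodule.

End MonomialSyzygies.

(** * Spanning sets of edges and the exchange argument *)

Section SpanningPairs.
Local Open Scope ring_scope.
Variables (n r : nat) (m : 'I_n -> 'X_{1..r}) (k : fieldType).
Local Notation S := {mpoly k[r]}.
Local Notation V := 'I_n.
Local Notation D1 := (vertex_boundary m k).
Local Notation x := (fun i => (mvars k r)`_i).
Local Notation label := (label m).
Implicit Types (e : V * V) (u w : 'X_{1..r}) (E : {set V * V}).

Lemma in_mongensP (p : S) :
  in_ideal (mongens m k) p <-> exists v : 'rV[S]_n, p%:M = v *m D1.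
Proof.
have sz : size (mongens m k) = n by rewrite size_map size_enum_ord.
have sumE (c : nat -> S) : \sum_(i < size (mongens m k)) c i * (mongens m k)`_i =
    \sum_(i < n) c i * 'X_[m i].
  rewrite -(big_mkord xpredT (fun i => c i * (mongens m k)`_i)) sz big_mkord.
  apply: eq_bigr => i _.
  by rewrite (nth_map i) ?size_enum_ord // nth_ord_enum.
split=> [[c ->]|[v /(congr1 (fun A : 'M_1 => A 0 0))]].
  exists (\row_i c i); apply/matrixP=> i j.
  rewrite [i]ord1 [j]ord1 mul_vertex_boundary mxE eqxx mulr1n sumE.
  by apply: eq_bigr => l _; rewrite mxE.
rewrite mxE eqxx mulr1n mul_vertex_boundary => ->.
pose c i := oapp (v 0) 0 (insub i); exists c; rewrite (sumE c) /c.
by apply: eq_bigr => i _; rewrite valK.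
Qed.

Lemma exact_mx b (D2 : 'M[S]_(b, n)) q (A : 'M[S]_(q, n)) :
  (forall v : 'rV[S]_n, v *m D1 = 0 -> exists a, v = a *m D2) ->
  A *m D1 = 0 -> exists B, A = B *m D2.
Proof.
move=> ex A0.
have /fin_all_exists[B BE] i : exists a : 'rV_b, row i A = a *m D2.
  by apply: ex; rewrite -row_mul A0 row0.
exists (\matrix_i B i); apply/row_matrixP=> i.
by rewrite row_mul rowK BE.
Qed.

(* A diagram chase in the tensor product of 0 -> S^b -> S^n -> S with the
   Koszul complex: a relation a among the rows of D2 is pushed to a class in
   H_3(x; S/I), and the vanishing of the latter gives a = \sum_l x_l a_l for
   relations a_l. Iterating, a lies in every power of (x). *)
Lemma relation_eq0 b (s : 'I_b -> V * V) (D2 := syz_mx m k s) :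
  kos_vanish x (mongens m k) r 2 ->
  (forall v : 'rV[S]_n, v *m D1 = 0 -> exists a, v = a *m D2) ->
  (forall a : 'rV[S]_b, a *m D2 = 0 -> forall i, (a 0 i)@_0%MM = 0) ->
  forall a : 'rV[S]_b, a *m D2 = 0 -> a = 0.
Proof.
move=> van ex minl.
have step (a : 'M[S]_(kos_rank 0 r, b)) : a *m D2 = 0 ->
    exists2 c : 'M[S]_(kos_rank 1 r, b), a = kos_d x r 0 *m c & c *m D2 = 0.
  move=> a0; have /(kos_d0_image a (leqnn r))[c cE] :
      forall j w, (forall l : 'I_r, (l < r)%N -> w l = 0%N) -> (a 0 j)@_w = 0.
    move=> j w w0; rewrite (_ : w = 0%MM) ?minl //.
    by apply/mnmP=> l; rewrite mnm0E w0.
  (* [c *m D2] is a 1-cycle; its lift [d] times [D1] is a 2-cycle, whose lift [z] is a 3-cycle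
     modulo the ideal. *)
  have [|d dE] := @kos_exact_mvars k r _ _ (c *m D2).
    by rewrite mulmxA -cE.
  have [|z zE] := @kos_exact_mvars k r _ _ (d *m D1).
    by rewrite mulmxA -dE -mulmxA syz_mxK mulmx0.
  have [|w wI] := van z.
    move=> i j; rewrite [j]ord1 -zE; apply/in_mongensP; exists (row i d).
    by apply/matrixP=> i' j'; rewrite [i']ord1 [j']ord1 -row_mul !mxE eqxx.
  have /fin_all_exists[y yE] i : exists v : 'rV[S]_n,
      ((z - kos_d x r 3 *m w) i 0)%:M = v *m D1 by apply/in_mongensP.
  have {yE} zE' : z = kos_d x r 3 *m w + (\matrix_i y i) *m D1.
    apply/eqP; rewrite addrC -subr_eq; apply/eqP/row_matrixP=> i.
    rewrite row_mul rowK -yE; apply/matrixP=> i' j'.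
    by rewrite [i']ord1 [j']ord1 [RHS]mxE eqxx mulr1n mxE.
  (* The corrected [d] is killed by [D1], hence equals [t *m D2]; the boundary of [t] then corrects
     [c]. *)
  have [|t tE] := exact_mx (A := d - kos_d x r 2 *m \matrix_i y i) ex.
    rewrite mulmxBl zE zE' mulmxDr mulmxA kos_dd mul0mx add0r mulmxA subrr //.
  exists (c - kos_d x r 1 *m t).
    by rewrite mulmxBr mulmxA kos_dd mul0mx subr0.
  rewrite mulmxBl dE -mulmxA -tE mulmxBr mulmxA kos_dd mul0mx subr0 subrr //.
have ord N : forall a : 'rV[S]_b, a *m D2 = 0 ->
    forall j w, (mdeg w < N)%N -> (a 0 j)@_w = 0.
  elim: N => [|N IHN] a //; move=> /(@step a)[c -> c0].
  apply: kos_d0_order => i j w ltw.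
  by have := IHN (row i c) _ j w ltw; rewrite mxE; apply; rewrite -row_mul c0 row0.
move=> a a0; apply/rowP=> j; rewrite mxE; apply/mpolyP=> w; rewrite mcoeff0.
exact: (ord (mdeg w).+1).
Qed.

(** Testing u = lcm(m_i, m_j) is enough: if m_i and m_j divide [u], so does their lcm. *)
Definition spanning E : bool :=
  [forall i, forall j, connect (link [pred e in E | (label e <= label (i, j))%MM]) i j].

Lemma spanningP E : reflect
  (forall i j, connect (link [pred e in E | (label e <= label (i, j))%MM]) i j)
  (spanning E).
Proof. by apply: (iffP forallP) => sp i; apply/forallP/sp. Qed.

Lemma syz_mx_exact E b (s : 'I_b -> V * V) : spanning E ->
  (forall e, e \in E -> exists a, edge_syz m k e = a *m syz_mx m k s) ->
  forall v : 'rV[S]_n, v *m D1 = 0 -> exists a, v = a *m syz_mx m k s.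
Proof.
move=> /spanningP spE Es v.
apply: (@syz_generated n r m k (fun v => exists a, v = a *m syz_mx m k s)
  _ _ _ (fun e => e \in E)) => //.
- by exists 0; rewrite mul0mx.
- by move=> _ _ [a ->] [c ->]; exists (a + c); rewrite mulmxDl.
- by move=> c _ [a ->]; exists (c *: a); rewrite scalemxAl.
Qed.

Lemma spanningT : spanning setT.
Proof.
apply/spanningP=> i j; apply: connect1.
by rewrite /link /= inE lepm_refl.
Qed.

Lemma spanning_sub E E' : E \subset E' -> spanning E -> spanning E'.
Proof.
move=> /subsetP EE' /spanningP sp; apply/spanningP=> i j.
by apply: sub_connect_link (sp i j) => e /= /andP[/EE'-> ->].
Qed.

Lemma spanning_replace E E' f : spanning E -> {subset E :\ f <= E'} ->
  connect (link [pred e in E' | (label e <= label f)%MM]) f.1 f.2 -> spanning E'.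
Proof.
move=> /spanningP sp EE' conf; apply/spanningP=> i j.
apply: connect_sub (sp i j) => y z.
suff sub e : e \in E -> (label e <= label (i, j))%MM ->
    connect (link [pred e' in E' | (label e' <= label (i, j))%MM]) e.1 e.2.
  by case/orP=> /andP[/sub Ee /Ee //]; rewrite connect_link_sym.
move=> Ee le_e; have [ef|ef] := eqVneq e f.
  rewrite ef in le_e *; apply: sub_connect_link conf => e' /= /andP[-> le_e'].
  exact: lepm_trans le_e' le_e.
by apply/connect1/orP; left; rewrite /= EE' ?inE ?ef -?surjective_pairing //= Ee.
Qed.

Definition min_spanning E :=
  spanning E /\ forall E', spanning E' -> (#|E| <= #|E'|)%N.

(** If a relation had a nonzero constant coefficient at an edge, the cut functional at its label
    would show its endpoints joined by other edges with labels dividing it. The edge could be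
    dropped, against minimality; hence [relation_eq0] applies. *)
Lemma min_spanning_syz_eq0 E (s : 'I_#|E| -> V * V := fun i => enum_val i) :
  kos_vanish x (mongens m k) r 2 -> min_spanning E ->
  forall a : 'rV[S]_#|E|, a *m syz_mx m k s = 0 -> a = 0.
Proof.
move=> van [spE minE]; apply: relation_eq0 => //.
  apply: (syz_mx_exact spE) => e Ee; exists (delta_mx 0 (enum_rank_in Ee e)).
  by rewrite -rowE rowK /s enum_rankK_in.
move=> a a0 i; apply: contraNeq (negbT (ltnn #|E|)) => ai0.
have Ei := enum_valP i; apply: (@leq_ltn_trans #|E :\ s i|); last first.
  by rewrite [X in (_ < X)%N](cardsD1 (s i)) Ei.
apply: minE; apply: (spanning_replace (f := s i) spE) => [//|].
set P := [pred e | _]; pose C := [set z | connect (link P) (s i).1 z].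
have := syz_relation_cut (i := i) (u := label (s i)) (C := C) a0.
rewrite mcoeffMXE lepm_refl (_ : label (s i) - label (s i) = 0)%MM; last first.
  by apply/mnmP=> l; rewrite mnmBE subnn mnm0E.
move=> /(_ ai0); rewrite !inE connect0 => <- // j ji le_j.
apply: mem_connect_class; first exact: connect_link_sym.
apply/connect1/orP; left; rewrite /P /= -surjective_pairing le_j andbT.
by rewrite !inE enum_valP andbT (inj_eq enum_val_inj).
Qed.

Lemma label_le_sum e : (label e <= \sum_i m i)%MM.
Proof.
have le_m i : (m i <= \sum_i m i)%MM by rewrite (bigD1 i) //= lem_addr.
by rewrite label_le !le_m.
Qed.

(** A path joining the endpoints of [f] without [f] telescopes, in a multidegree divisible by all
    labels, to a relation with nonzero coefficient at [f]. *)
Lemma min_spanning_bridge E f :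
  kos_vanish x (mongens m k) r 2 -> min_spanning E -> f \in E ->
  ~~ connect (link (mem (E :\ f))) f.1 f.2.
Proof.
move=> van minE Ef; apply/negP=> conf.
pose s (i : 'I_#|E|) : V * V := enum_val i; pose i0 := enum_rank_in Ef f.
have si0 : s i0 = f by rewrite /s enum_rankK_in.
pose W (v : 'rV[S]_n) := exists2 a : 'rV_#|E|, a 0 i0 = 0 & v = a *m syz_mx m k s.
pose u := (\sum_i m i)%MM.
have WD (v v' : 'rV[S]_n) : W v -> W v' -> W (v + v').
  by move=> [a a0 ->] [b b0 ->]; exists (a + b); rewrite ?mxE ?a0 ?b0 ?addr0 ?mulmxDl.
have WZ c (v : 'rV[S]_n) : W v -> W (c *: v).
  by move=> [a a0 ->]; exists (c *: a); rewrite ?mxE ?a0 ?mulr0 ?scalemxAl.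
have W0 : W 0 by exists 0; rewrite ?mxE ?mul0mx.
have [e|a a0] := @path_syz n r m k W W0 WD WZ (mem (E :\ f)) u _ _ _ conf.
  rewrite !inE => /andP[ef Ee]; split; first exact: label_le_sum.
  exists (delta_mx 0 (enum_rank_in Ef e)); last by rewrite -rowE rowK /s enum_rankK_in.
  rewrite mxE eqxx /=; case: eqP => // i0E; case/eqP: ef.
  by rewrite -si0 i0E /s enum_rankK_in.
rewrite -edge_syz_scale ?label_le_sum // -si0 => aE.
have /(min_spanning_syz_eq0 van minE)/rowP/(_ i0)/eqP :
    ('X_[u - label (s i0)] *: delta_mx 0 i0 - a) *m syz_mx m k s = 0.
  by rewrite mulmxBl -aE -scalemxAl -rowE rowK subrr.
by rewrite !mxE a0 subr0 !eqxx mulr1 -msize_poly_eq0 msizeX.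
Qed.

(** This weakens [spanning] by comparing total degrees in place of divisibility; it is the
    bottleneck property of trees built by Kruskal's algorithm. *)
Definition kruskal E : Prop := forall i j,
  connect (link [pred e in E | (mdeg (label e) <= mdeg (label (i, j)))%N]) i j.

Lemma lepm_mdeg_eq u w : (u <= w)%MM -> (mdeg w <= mdeg u)%N -> u = w.
Proof.
move=> le_uw le_wu; have := submK le_uw => wE.
move: le_wu; rewrite -{1}wE mdegD -{2}[mdeg u]add0n leq_add2r leqn0 mdeg_eq0.
by move=> /eqP w0; rewrite -wE w0 add0m.
Qed.

Lemma kruskal_exchange E T f :
  kruskal T -> (forall i j, ((i, j) \in T) = ((j, i) \in T)) ->
  spanning E -> f \in E -> f \notin T -> ~~ connect (link (mem (E :\ f))) f.1 f.2 ->
  exists g, [/\ g \in T, g \notin E & spanning (g |: (E :\ f))].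
Proof.
move=> krT symT spE Ef NTf Nf; pose L := link (mem (E :\ f)).
have symL : connect_sym L by apply: connect_link_sym.
pose C := [set z | connect L f.1 z].
have [||y [z [Tyz yC zNC]]] := connect_crossing (C := C) (krT f.1 f.2).
- by rewrite inE connect0.
- by rewrite inE.
have {Tyz} [Tg deg_g] : (y, z) \in T /\ (mdeg (label (y, z)) <= mdeg (label f))%N.
  case/orP: Tyz => /andP[/=]; first by rewrite -surjective_pairing.
  by rewrite symT -surjective_pairing /label /edge_label /= mlcmC.
have NLyz : ~~ connect L y z.
  apply: contra zNC => Lyz; move: yC; rewrite !inE => Ly.
  exact: connect_trans Ly Lyz.
have NEg : (y, z) \notin E.
  apply: contra NLyz => Eg; apply/connect1/orP; left; rewrite /= !inE Eg andbT.
  by apply: contraNneq NTf => <-.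
have sp_g := spanningP _ spE y z.
exists (y, z); split=> //; apply: (spanning_replace (f := f) spE).
  by move=> e Ee; rewrite inE Ee orbT.
(* Otherwise a path of [E] from [y] to [z] below this label would avoid [f], although the cut
   separates them. *)
have le_fg : (label f <= label (y, z))%MM.
  apply: contraR NLyz => Nle; apply: sub_connect_link sp_g => e /= /andP[Ee le_e].
  by rewrite !inE Ee andbT; apply: contraNneq Nle => <-.
have fgE : label f = label (y, z) by apply: lepm_mdeg_eq.
pose R := link [pred e in E :\ f | (label e <= label f)%MM].
have symR : connect_sym R by apply: connect_link_sym.
have RL a b : connect R a b -> connect L a b.
  by apply: sub_connect_link => e /= /andP[].
(* A path of [E] below this label leaves the [R]-class of [a] only through [f], so the class
   contains an endpoint of [f]. *)
have cross a b (D := [set w | connect R a w]) :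
    connect (link [pred e in E | (label e <= label (y, z))%MM]) a b -> ~~ connect L a b ->
    (f.1 \in D) || (f.2 \in D).
  move=> Eab NLab; have [||v [w [Evw vD wND]]] := connect_crossing (C := D) Eab.
  - by rewrite inE connect0.
  - by rewrite inE; apply: contra NLab => /RL.
  apply: contraR wND; rewrite negb_or => /andP[f1D f2D].
  rewrite -(@mem_connect_class _ R a v w) //; apply: connect1.
  have sub e : e \in E -> (label e <= label (y, z))%MM -> e != f ->
    (e \in E :\ f) && (label e <= label f)%MM.
    by move=> Ee le_e ef; rewrite !inE Ee ef fgE.
  case/orP: Evw => /andP[Ee le_e]; apply/orP; [left|right]; apply: sub => //.
    by apply: contraNneq f1D => <-.
  by apply: contraNneq f2D => <-.
have sub_R a b : connect R a b ->
    connect (link [pred e in (y, z) |: E :\ f | (label e <= label f)%MM]) a b.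
  by apply: sub_connect_link => e /= /andP[Ee ->]; rewrite inE Ee orbT.
(* Since [y] is on the side of [f.1] and [z] is not, [R] joins [y] to [f.1] and [z] to [f.2]; with
   the edge (y, z) this gives a path replacing [f]. *)
have /orP[] := cross y z sp_g NLyz; rewrite inE => Ry; last first.
  case/negP: Nf; apply: connect_trans (RL _ _ Ry).
  by move: yC; rewrite inE.
have /orP[] : (f.1 \in [set w | connect R z w]) || (f.2 \in [set w | connect R z w]).
- by apply: (cross z y); [rewrite connect_link_sym | rewrite symL].
- by rewrite inE => /RL Lz; case/negP: zNC; rewrite inE symL.
rewrite inE => Rz; apply: (@connect_trans _ _ y); first by rewrite connect_link_sym sub_R.
apply: (@connect_trans _ _ z); last exact: sub_R.
by apply/connect1/orP; left; rewrite /= !inE eqxx fgE lepm_refl.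
Qed.

(** A spanning set of least cardinality that meets [T] the most lies in [T]: an exchange would
    enlarge the intersection. *)
Lemma kruskal_spanning T : kos_vanish x (mongens m k) r 2 ->
  kruskal T -> (forall i j, ((i, j) \in T) = ((j, i) \in T)) -> spanning T.
Proof.
move=> van krT symT.
case: (arg_minnP (fun E : {set V * V} => #|E|) spanningT) => E0 spE0 minE0.
pose P (E : {set V * V}) := spanning E && (#|E| == #|E0|).
have PE0 : P E0 by rewrite /P spE0 eqxx.
case: (arg_maxnP (fun E : {set V * V} => #|E :&: T|) PE0) => E /andP[spE /eqP cardE] maxE.
have minE : min_spanning E by split=> // E' /minE0; rewrite cardE.
apply: (spanning_sub _ spE); apply/subsetP=> f Ef; apply: contraT => NTf.
have [g [Tg NEg spg]] :=
  kruskal_exchange krT symT spE Ef NTf (min_spanning_bridge van minE Ef).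
have /maxE : P (g |: (E :\ f)).
  rewrite /P spg cardsU1 !inE (negPf NEg) andbF /=.
  by rewrite -cardE [X in _ == X](cardsD1 f) Ef.
rewrite /= leqNgt => /negP[]; apply: proper_card; apply/properP; split.
  apply/subsetP=> e; rewrite !inE => /andP[Ee Te]; rewrite Ee Te !andbT.
  by rewrite (contraNneq _ NTf) ?orbT // => <-.
by exists g; rewrite !inE ?eqxx ?Tg // (negPf NEg).
Qed.

End SpanningPairs.

(** * Forests and trees *)

Section SimpleGraphs.
Variable T : finType.
Implicit Types (G H : sgraph T) (x y z : T) (e : {set T}).

Lemma set2_eqP x y x' y' : [set x; y] = [set x'; y'] ->
  (x, y) = (x', y') \/ (x, y) = (y', x').
Proof.
move=> /setP E; have := E x; rewrite !inE eqxx => /esym/orP[/eqP xE|/eqP xE].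
  left; subst x'; have := E y'; rewrite !inE eqxx orbT => /orP[/eqP yE|/eqP->//].
  by subst y'; have := E y; rewrite !inE eqxx orbT orbb => /esym/eqP->.
right; subst y'; have := E x'; rewrite !inE eqxx => /orP[/eqP yE|/eqP->//].
by subst x'; have := E y; rewrite !inE eqxx orbT orbb => /esym/eqP->.
Qed.

Lemma adj_sym G : ssrbool.symmetric (adj G).
Proof. by move=> x y; rewrite /adj setUC. Qed.

Lemma connect_adj_sym G : connect_sym (adj G).
Proof. exact/sym_connect_sym/adj_sym. Qed.

Lemma adj_irrefl G x y : adj G x y -> x != y.
Proof.
move=> Gxy; have /forall_inP/(_ _ Gxy) := edgesP G.
by rewrite cards2; case: (x != y).
Qed.

Lemma adj_vertexl G x y : adj G x y -> x \in vertices G.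
Proof.
move=> Gxy; have /forall_inP/(_ _ Gxy)/andP[_ /subsetP] := edgesP G.
by apply; rewrite !inE eqxx.
Qed.

Lemma sgraph_eq G H : vertices G = vertices H -> edges G = edges H -> G = H.
Proof.
case: G H => [vG eG pG] [vH eH pH] /= vE eE; subst vH eH.
by congr SGraph; apply: bool_irrelevance.
Qed.

Lemma acyclic_subgraph H G : edges H \subset edges G -> acyclic G -> acyclic H.
Proof.
move=> /subsetP HG acG [//|z c] ltc; apply: contra (acG _ ltc) => /andP[cycH uc].
by rewrite /ucycleb uc andbT /=; apply: sub_path cycH => x y; apply: HG.
Qed.

(** A simple path from [x] to [y] avoiding the edge has an inner vertex, so the edge closes it to a
    cycle on at least three vertices. *)
Lemma acyclic_bridge G x y : acyclic G -> adj G x y ->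
  ~~ connect (fun z w => adj G z w && ([set z; w] != [set x; y])) x y.
Proof.
move=> acG Gxy; apply/negP=> /connectP[p pth yE].
case/shortenP: pth yE => q pth uq _ {p} yE.
have size_q : (2 < size (x :: q))%N.
  case: q pth uq yE => [|z [|w q]] //=.
    by move=> _ _ yx; have := adj_irrefl Gxy; rewrite yx eqxx.
  by move=> /andP[/andP[_ nxz] _] _ yz; rewrite yz eqxx in nxz.
have /negP[] := acG _ size_q; apply/andP; split=> //=.
rewrite rcons_path -yE adj_sym Gxy andbT.
by apply: sub_path pth => z w /andP[].
Qed.

Lemma eq_components_adj H G : components H = components G ->
  subrel (adj G) (connect (adj H)).
Proof.
move=> HG x y Gxy.
have : [set z | connect (adj G) x z] \in components G.
  by apply/imsetP; exists x => //; apply: adj_vertexl Gxy.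
rewrite -HG => /imsetP[w _ /setP E].
have := E x; have := E y; rewrite !inE connect0 (connect1 Gxy).
move=> /esym wy /esym wx; apply: connect_trans wy.
by rewrite connect_adj_sym.
Qed.

Lemma connected_graph_connect G x y : connected_graph G ->
  x \in vertices G -> y \in vertices G -> connect (adj G) x y.
Proof.
move=> /eqP/cards1P[A GA] Gx Gy.
have inA z : z \in vertices G -> [set w | connect (adj G) z w] = A.
  by move=> Gz; apply/set1P; rewrite -GA; apply: imset_f.
have := inA x Gx; rewrite -(inA y Gy) => /setP/(_ y).
by rewrite !inE connect0.
Qed.

End SimpleGraphs.

(** * Labelled trees and forest sequences *)

Section LabelledTrees.
Local Open Scope ring_scope.
Variables (n r : nat) (m : 'I_n -> 'X_{1..r}) (k : fieldType).
Local Notation S := {mpoly k[r]}.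
Local Notation V := 'I_n.
Local Notation x := (fun i => (mvars k r)`_i).
Local Notation label := (label m).
Implicit Types (T : sgraph V) (o : {set V} -> V * V).

Lemma lepm_mdeg (u w : 'X_{1..r}) : (u <= w)%MM -> (mdeg u <= mdeg w)%N.
Proof. by move=> /submK <-; rewrite mdegD leq_addl. Qed.

Lemma mem_Kle_edges d i j :
  ([set i; j] \in Kle_edges m d) = (i != j) && (mdeg (label (i, j)) <= d)%N.
Proof.
rewrite inE; apply/existsP/andP=> [[i' /existsP[j']]|[nij le_d]]; last first.
  by exists i; apply/existsP; exists j; rewrite eqxx nij.
case/and3P=> /eqP ij nij le_d.
case: (set2_eqP ij) => -[-> ->]; rewrite ?nij //.
by rewrite eq_sym nij /label /edge_label mlcmC.
Qed.

(** Both orientations of each edge are included, so the set is independent of the choice of an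
    orientation. *)
Definition pairs T : {set V * V} := [set p | [set p.1; p.2] \in edges T].

Lemma pairs_sym T i j : ((i, j) \in pairs T) = ((j, i) \in pairs T).
Proof. by rewrite !inE /= setUC. Qed.

Lemma edge_boundaryE T o :
  edge_boundary m k T o = syz_mx m k (fun a => o (enum_val a)).
Proof.
apply/matrixP=> a l; rewrite !mxE; case: (o _) => i j /=.
by rewrite !mulr_natr.
Qed.

(** Every edge of a forest is a bridge, and the cut it defines isolates its coefficient in a
    relation. *)
Lemma acyclic_syz_eq0 T o : acyclic T -> orientation T o ->
  forall a : 'rV_#|edges T|, a *m syz_mx m k (fun t => o (enum_val t)) = 0 -> a = 0.
Proof.
move=> acT oT a a0; apply/rowP=> i; rewrite mxE; apply/mpolyP=> w; rewrite mcoeff0.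
have Ti := enum_valP i; have oi := oT _ Ti.
have Tadj : adj T (o (enum_val i)).1 (o (enum_val i)).2 by rewrite /adj -oi.
apply: contraNeq (acyclic_bridge acT Tadj) => ai.
set e := (fun z w => _); pose C := [set z | connect e (o (enum_val i)).1 z].
have e_sym : ssrbool.symmetric e by move=> z w'; rewrite /e adj_sym setUC.
pose u := (w + label (o (enum_val i)))%MM.
have := syz_relation_cut (i := i) (u := u) (C := C) a0.
rewrite mcoeffMXE lem_addl addmK => /(_ ai); rewrite !inE connect0 => <- // j ji _.
apply: mem_connect_class; first exact: sym_connect_sym.
have oj := oT _ (enum_valP j); apply: connect1; rewrite /e /adj -oj -oi enum_valP.
by rewrite (inj_eq enum_val_inj).
Qed.

Lemma cellular_resolution T o :
  (forall i, m i != 0%MM) -> (forall i j, i != j -> ~~ (m i <= m j)%MM) ->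
  spanning m (pairs T) -> acyclic T -> orientation T o ->
  minimal_cellular_resolution m k T o.
Proof.
move=> m0 m_min spT acT oT; rewrite /minimal_cellular_resolution edge_boundaryE.
set s := fun a => o _.
split=> [|v|p|a l|i j]; first exact: acyclic_syz_eq0.
- split=> [v0|[a ->]]; last by rewrite -mulmxA syz_mxK mulmx0.
  apply: (syz_mx_exact spT _ v0) => -[i j]; rewrite inE /= => Tij.
  pose t := enum_rank_in Tij [set i; j].
  have st : [set i; j] = [set (s t).1; (s t).2].
    by rewrite /s -oT ?enum_valP // enum_rankK_in.
  case: (set2_eqP st) => ->.
    by exists (delta_mx 0 t); rewrite -rowE rowK -surjective_pairing.
  exists (- delta_mx 0 t); rewrite mulNmx -rowE rowK /edge_syz opprB /=.
  by rewrite /label /edge_label mlcmC.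
- exact: in_mongensP.
(* A unit entry would make the lcm equal to one of the two generators, which the other would then
   divide. *)
- have nst : (s a).1 != (s a).2.
    by apply: (@adj_irrefl _ T); rewrite /adj -oT ?enum_valP.
  rewrite !mxE mulrC [X in _ - X]mulrC; apply: in_idealB; apply/in_idealMl/in_mvarsX.
    apply: contra (m_min _ _ nst) => /eqP/mnmP E; apply/mnm_lepP=> t.
    have /eqP := E t; rewrite mnmBE mnm0E subn_eq0; apply: leq_trans.
    by rewrite /label /edge_label mnmE leq_maxl.
  apply: contra (m_min _ _ _) => [/eqP/mnmP E|]; last by rewrite eq_sym; exact: nst.
  apply/mnm_lepP=> t.
  have /eqP := E t; rewrite mnmBE mnm0E subn_eq0; apply: leq_trans.
  by rewrite /label /edge_label mnmE leq_maxr.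
- by rewrite mxE; apply: in_mvarsX.
Qed.

(** The component of [i] among the edges of [T] with label dividing that of (i, j) is crossed by
    none of them, so by exactness (i, j) does not cross it either. *)
Lemma resolution_spanning T o : orientation T o ->
  minimal_cellular_resolution m k T o -> spanning m (pairs T).
Proof.
move=> oT [_ ex _ _ _]; rewrite edge_boundaryE in ex; apply/spanningP=> i j.
set P := [pred e | _]; pose C := [set z | connect (link P) i z].
have := @syz_exact_cut n r m k _ _ (fun v => (ex v).1) (i, j) C.
rewrite !inE connect0 => <- // t le_t.
apply: mem_connect_class; first exact: connect_link_sym.
apply/connect1/orP; left; rewrite /P /= -surjective_pairing le_t andbT inE.
by rewrite -oT ?enum_valP.
Qed.

(** With [D] the degree of the edge, [F D] joins its endpoints, and [F D] lies in [F d]: by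
    monotonicity if [D] is at most [d], by stability otherwise. *)
Lemma forest_kruskal F d : forest_sequence m F ->
  (forall i, (d <= i)%N -> F i = F d) -> kruskal m (pairs (F d)).
Proof.
move=> [monoF spF] stabF i j; set D := mdeg _.
have [<-|nij] := eqVneq i j; first exact: connect0.
have [sub _ _ /eq_components_adj/(_ i j)] := spF D.
have subD : subgraph (F D) (F d).
  by have [/monoF//|/ltnW/stabF->] := leqP D d; apply/andP.
rewrite /adj /= mem_Kle_edges nij leqnn => /(_ isT).
apply: connect_sub => y z FDyz; apply/connect1/orP; left=> /=.
case/andP: subD => _ /subsetP/(_ _ FDyz) Fyz; rewrite inE Fyz.
case/andP: sub => _ /subsetP/(_ _ FDyz); rewrite mem_Kle_edges.
by case/andP.
Qed.

(** The forest [F d] already connects all vertices, so a further edge would close a cycle. *)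
Lemma forest_sequence_stable F d : forest_sequence m F -> Kle_spans m d ->
  forall i, (d <= i)%N -> F i = F d.
Proof.
move=> [monoF spF] [Vd conn_d] i le_di.
have /andP[Vsub Esub] := monoF _ _ le_di.
have [_ VFd _ comp_d] := spF d; have [_ _ acFi _] := spF i.
have VFdT : vertices (F d) = [set: V] by rewrite VFd.
apply: sgraph_eq; first by apply/eqP; rewrite eqEsubset Vsub VFdT subsetT.
apply/eqP; rewrite eqEsubset Esub andbT; apply/subsetP=> e Fe.
have /forall_inP/(_ _ Fe)/andP[/cards2P[y [z [_ eE]]] _] := edgesP (F i).
rewrite eE in Fe *; apply: contraT => NFe.
have /negP[] := acyclic_bridge acFi Fe.
have conn_Fd : connected_graph (F d) by rewrite /connected_graph comp_d.
have := connected_graph_connect (x := y) (y := z) conn_Fd.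
rewrite VFdT !inE => /(_ isT isT); apply: connect_sub => v w Fvw.
apply: connect1; rewrite /adj (subsetP Esub) //=.
by apply: contraNneq NFe => <-.
Qed.

(** In the degree of the product of all generators the graph is complete; [0 < n] excludes the empty
    graph, which has no component. *)
Lemma Kle_spans_sum : (0 < n)%N -> Kle_spans m (mdeg (\sum_i m i)%MM).
Proof.
move=> n0; have VT : vertices (Kle m (mdeg (\sum_i m i)%MM)) = [set: V].
  apply/setP=> i; rewrite !inE lepm_mdeg // (bigD1 i) //= lem_addr //.
split=> //; apply/eqP/cards1P; exists [set: V].
have cl i : [set j | connect (adj (Kle m (mdeg (\sum_i m i)%MM))) i j] = [set: V].
  apply/setP=> j; rewrite !inE; have [<-|nij] := eqVneq i j; first exact: connect0.
  by apply: connect1; rewrite /adj /= mem_Kle_edges nij lepm_mdeg ?label_le_sum.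
apply/setP=> A; rewrite !inE; apply/imsetP/eqP=> [[i _ ->]|->]; first exact: cl.
by exists (Ordinal n0); rewrite ?VT ?inE // cl.
Qed.

Lemma truncation_subproof T d :
  [forall e in edges T :&: Kle_edges m d,
     (#|e| == 2%N) && (e \subset vertices (Kle m d))].
Proof.
apply/forall_inP=> e; rewrite inE => /andP[_ Ke].
by have /forall_inP/(_ e Ke) := edgesP (Kle m d).
Qed.

Definition truncation T d : sgraph V := SGraph (truncation_subproof T d).

(** The ends of an edge of [Kle m i] are joined in [T] by edges with labels dividing its label,
    hence of degree at most [i], so truncation keeps the components. *)
Lemma truncation_forest_sequence T : acyclic T -> spanning m (pairs T) ->
  forest_sequence m (truncation T).
Proof.
move=> acT /spanningP spT; split=> [i j le_ij|i].
  apply/andP; split; apply/subsetP=> e.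
    by rewrite !inE => /leq_trans; apply.
  rewrite /= !in_setI => /andP[-> Ke] /=.
  have /forall_inP/(_ _ Ke)/andP[/cards2P[v [w [_ eE]]] _] := edgesP (Kle m i).
  move: Ke; rewrite eE !mem_Kle_edges => /andP[->] /leq_trans; exact.
split=> //; first by apply/andP; split=> //; apply: subsetIr.
- by apply: acyclic_subgraph acT; apply: subsetIl.
apply: eq_imset => y; apply/setP=> z; rewrite !inE; apply/idP/idP.
  apply: connect_sub => v w /=; rewrite /adj /= inE => /andP[_ Kvw].
  exact: connect1.
apply: connect_sub => v w Kvw.
have le_i : (mdeg (label (v, w)) <= i)%N.
  by move: Kvw; rewrite /adj /= mem_Kle_edges => /andP[].
have sub a b : (a, b) \in pairs T -> (label (a, b) <= label (v, w))%MM ->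
    adj (truncation T i) a b.
  rewrite inE /= => Tab le_ab; rewrite /adj /= inE Tab mem_Kle_edges.
  by rewrite (adj_irrefl Tab) (leq_trans (lepm_mdeg le_ab)).
apply: connect_sub (spT v w) => a b /orP[]/andP[/sub Tab /Tab Fab].
  exact: connect1.
by apply: connect1; rewrite adj_sym.
Qed.

Lemma truncation_id T : (0 < n)%N -> vertices T = [set: V] ->
  truncation T (mdeg (\sum_i m i)%MM) = T.
Proof.
move=> n0 VT; apply: sgraph_eq => /=.
  by rewrite VT; case: (Kle_spans_sum n0).
apply/setIidPl/subsetP=> e Te.
have /forall_inP/(_ _ Te)/andP[/cards2P[y [z [nyz ->]]] _] := edgesP T.
by rewrite mem_Kle_edges nyz lepm_mdeg ?label_le_sum.
Qed.

End LabelledTrees.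

Lemma has_dim_uniq (R : comNzRingType) (g : seq R) d d' :
  has_dim g d -> has_dim g d' -> d = d'.
Proof.
move=> [[P Pd] maxd] [[P' Pd'] maxd']; apply/eqP; rewrite eqn_leq.
by rewrite (maxd' _ _ Pd) (maxd _ _ Pd').
Qed.

(** * Consequences of the hypotheses on the ideal *)

Section Hypotheses.
Local Open Scope ring_scope.
Variables (n r : nat) (m : 'I_n -> 'X_{1..r}) (k : fieldType).

(** The depth of S/I equals its dimension, which is dim S - 2, hence at least r - 2; a regular
    sequence of that length kills H_3. *)
Lemma cm_codim2_vanish : cohen_macaulay (mongens m k) ->
  has_codim (mongens m k) 2 ->
  kos_vanish (fun i => (mvars k r)`_i) (mongens m k) r 2.
Proof.
move=> [d [[[f [f_x f_reg sz_f]] _] dim_d]] [d' [dim_d' [_ dimS]]].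
apply: kos_vanish_regular f_reg _ => [p /f_x|]; first exact: kos_null_mvars.
rewrite sz_f (has_dim_uniq dim_d dim_d') addnC.
exact: dimS (prime_chain_mvars k r).
Qed.

Lemma codim2_pos : has_codim (mongens m k) 2 -> (0 < n)%N.
Proof.
move=> [d [dim_d dim_S]]; rewrite lt0n; apply/eqP=> n0.
have g0 : mongens m k = [::] by apply/size0nil; rewrite size_map size_enum_ord.
rewrite g0 in dim_d; have := has_dim_uniq dim_d dim_S.
by rewrite -[X in X = _]addn0 => /addnI.
Qed.

Lemma cm_generator_neq0 : cohen_macaulay (mongens m k) -> forall i, m i != 0%MM.
Proof.
move=> [d [[[f [_ [_ I_proper] _]] _] _]] i; apply/eqP=> mi; apply: I_proper.
apply: in_ideal_mem; rewrite mem_cat; apply/orP; left; apply/mapP.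
by exists i; rewrite ?mem_enum // mi mpolyX0.
Qed.

Lemma minimal_generators_antichain : minimal_generators m k ->
  forall i j, i != j -> ~~ (m i <= m j)%MM.
Proof.
move=> m_min i j nij; apply/negP=> /submK E; apply: (m_min j).
rewrite -E mpolyXD; apply/in_idealMl/in_ideal_mem/mapP.
by exists i; rewrite // mem_filter nij mem_enum.
Qed.

End Hypotheses.

Theorem proposition2p1 (k : fieldType) (r n : nat) (m : 'I_n -> 'X_{1..r})
    (m_min : minimal_generators m k)
    (I_cm : cohen_macaulay (mongens m k))
    (I_codim : has_codim (mongens m k) 2) :
  [/\ exists d : nat, Kle_spans m d,
      forall F : nat -> sgraph 'I_n, forest_sequence m F ->
      forall d : nat, Kle_spans m d ->
        (forall i : nat, (d <= i)%N -> F i = F d) /\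
        spanning_tree (F d) (complete_graph 'I_n),
      forall F : nat -> sgraph 'I_n, forest_sequence m F ->
      forall d : nat, Kle_spans m d ->
      forall o : {set 'I_n} -> 'I_n * 'I_n, orientation (F d) o ->
        minimal_cellular_resolution m k (F d) o
    & forall T : sgraph 'I_n, vertices T = [set: 'I_n] -> is_tree T ->
      forall o : {set 'I_n} -> 'I_n * 'I_n, orientation T o ->
        minimal_cellular_resolution m k T o ->
        exists F : nat -> sgraph 'I_n,
          forest_sequence m F /\
          exists d : nat, Kle_spans m d /\ T = F d].
Proof.
have n0 := codim2_pos I_codim; have van := cm_codim2_vanish I_cm I_codim.
split=> [|F fsF d Kd|F fsF d Kd o oF|T VT [_ acT] o oT resT].
- by exists (mdeg (\sum_i m i)%MM); apply: Kle_spans_sum.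
- split; first exact: forest_sequence_stable fsF Kd.
  have [_ VFd acFd comp_d] := fsF.2 d; split.
  + apply/andP; split; first by rewrite subsetT.
    apply/subsetP=> e Fe; rewrite inE.
    by have /forall_inP/(_ _ Fe)/andP[] := edgesP (F d).
  + by rewrite VFd; case: Kd.
  by split=> //; rewrite /connected_graph comp_d; case: Kd.
- have [_ _ acFd _] := fsF.2 d; apply: cellular_resolution => //.
  + exact: cm_generator_neq0 I_cm.
  + exact: minimal_generators_antichain m_min.
  apply: (kruskal_spanning van); last exact: pairs_sym.
  exact: forest_kruskal fsF (forest_sequence_stable fsF Kd).
exists (truncation m T); split.
  exact: truncation_forest_sequence (resolution_spanning oT resT).
exists (mdeg (\sum_i m i)%MM); split; first exact: Kle_spans_sum.
by rewrite truncation_id.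
Qed.
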